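(* Let $\mathcal{G}$ be a distance-regular graph with diameter $D(\mathcal{G})$. Then there exist $D(\mathcal{G})$ matrices in $\mathcal{M}(\mathcal{G})$ whose product equals a nonzero multiple of $\mathbf{1}\mathbf{1}^{T}$.
   Context: Graphs are finite, simple and undirected. For a graph $\mathcal{G}=(\mathcal{V},\mathcal{E})$ with vertices $1,\dots,N$, the set of matrices that comply with $\mathcal{G}$ is $$\mathcal{M}(\mathcal{G}) = \{A=[a_{ij}]\in\mathbb{R}^{N\times N} : \text{for all } i\neq j,\ (i,j)\notin\mathcal{E} \Rightarrow a_{ij}=0\}.$$ The vector $\mathbf{1}\in\mathbb{R}^N$ is the column vector of ones. The distance between two vertices of a connected graph is the number of edges in a shortest path between them, and the diameter is the maximum distance. Let $\mathcal{G}_r(i)$ denote the set of nodes at distance $r$ from node $i$. A connected graph $\mathcal{G}$ with diameter $D$ is distance-regular if there exist integers $b_0,b_1,\dots,b_{D-1},c_1,c_2,\dots,c_D$ such that for any pair $i,j$ of vertices at distance $r$: (1) for $1\leq r\leq D$, $c_r$ is the number of vertices in $\mathcal{G}_{r-1}(j)$ that are adjacent to $i$; (2) for $0\leq r\leq D-1$, $b_r$ is the number of vertices in $\mathcal{G}_{r+1}(j)$ that are adjacent to $i$. *)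

(* Defs.v *)
From mathcomp Require Import all_boot all_order all_algebra.
From mathcomp Require Import reals.

Set Implicit Arguments.
Unset Strict Implicit.
Unset Printing Implicit Defensive.

Import Order.TTheory GRing.Theory Num.Theory.

Record simple_graph (N : nat) := SimpleGraph {
  adj : rel 'I_N;
  adj_sym : symmetric adj;
  adj_irr : irreflexive adj
}.

Definition path_of_length (N : nat) (G : simple_graph N) (k : nat)
    (i j : 'I_N) : bool :=
  [exists p : k.-tuple 'I_N,
    [&& path (adj G) i p, last i p == j & uniq (i :: p)]].

(* Paths have distinct vertices, hence fewer than N edges, so it is enough to
   search the lengths 0, ..., N - 1; the value is N if j is unreachable from i. *)
Definition dist (N : nat) (G : simple_graph N) (i j : 'I_N) : nat :=
  find (fun k => path_of_length G k i j) (iota 0 N).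

Definition connected_graph (N : nat) (G : simple_graph N) : Prop :=
  forall i j : 'I_N, connect (adj G) i j.

Definition diameter (N : nat) (G : simple_graph N) : nat :=
  \max_(i < N) \max_(j < N) dist G i j.

Definition sphere (N : nat) (G : simple_graph N) (r : nat) (i : 'I_N) :
    {set 'I_N} :=
  [set j | dist G i j == r].

(* Only b 0, ..., b (D - 1) and c 1, ..., c D are constrained, where D is the
   diameter. *)
Definition distance_regular (N : nat) (G : simple_graph N) : Prop :=
  connected_graph G /\
  exists b c : nat -> nat, forall (r : nat) (i j : 'I_N), dist G i j = r ->
    (1 <= r <= diameter G ->
       c r = #|[set k in sphere G r.-1 j | adj G i k]|) /\
    (r < diameter G ->
       b r = #|[set k in sphere G r.+1 j | adj G i k]|).

Local Open Scope ring_scope.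

Definition complies (R : realType) (N : nat) (G : simple_graph N)
    (A : 'M[R]_N) : Prop :=
  forall i j : 'I_N, i != j -> ~~ adj G i j -> A i j = 0.

Definition ones (R : realType) (N : nat) : 'cV[R]_N := const_mx 1.

(* Main.v *)
(** Let [A] be the adjacency matrix, [D] the diameter, [k] the valency, and let
    [B_t] be the 0-1 matrix of the pairs at distance less than [t].  The
    intersection numbers give
      [A B_(t+1) = k B_t + (k - b_t) (B_(t+1) - B_t) + c_(t+1) (B_(t+2) - B_(t+1))],
    so the all-ones matrix [B_(D+1)] is [p(A)] with [deg p <= D].  It remains to
    split [p] into [D] real linear factors.  A nonzero polynomial annihilating
    [A] has degree at least [D + 1], since an entry of [A ^ m] indexed by a pair
    at distance [m] is positive while the lower powers vanish there; hence
    [p (X - k)], which annihilates [A], has minimal degree.  If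
    [(X - a)^2 + b^2] with [b <> 0] divided [p], say [p = q ((X - a)^2 + b^2)],
    then [H = (q (X - k))(A)] would be nonzero, yet taking the trace of
    [H^T ((A - a)^2 + b^2) H = 0], with [A] symmetric, gives
    [|(A - a) H|^2 + b^2 |H|^2 = 0]. *)

Require Import Defs.
From mathcomp Require Import all_boot all_order all_algebra.
From mathcomp Require Import reals.
From mathcomp Require Import complex.

Set Implicit Arguments.
Unset Strict Implicit.
Unset Printing Implicit Defensive.
Import Order.TTheory GRing.Theory Num.Theory.

Local Open Scope ring_scope.

(** * Walks and the graph distance *)

Section Distance.
Variables (N : nat) (G : simple_graph N).
Local Notation adj := (adj G).
Local Notation dist := (dist G).

Lemma path_of_lengthP k i j :
  reflect (exists p, [/\ path adj i p, last i p = j, uniq (i :: p) & size p = k])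
          (path_of_length G k i j).
Proof.
apply: (iffP existsP) => [[p /and3P[hp /eqP hl hu]]|[p [hp hl hu /eqP hs]]].
  by exists p; split=> //; rewrite size_tuple.
by exists (Tuple hs); rewrite hp hu hl eqxx.
Qed.

(** A walk shortens to a simple path. Were that path shorter than [dist], its length would lie in
    the searched range [iota 0 N], and [find] would have stopped there. *)
Lemma dist_le_walk i p : path adj i p -> (dist i (last i p) <= size p)%N.
Proof.
move=> hp; have [p' hp' hu hs] := shortenP hp.
have le_s : (size p' <= size p)%N.
  by apply: uniq_leq_size => //; case/andP: hu.
apply: leq_trans le_s; rewrite leqNgt; apply/negP => lt_s.
have lt_N : (size p' < N)%N.
  by apply: leq_trans lt_s _; rewrite (leq_trans (find_size _ _)) ?size_iota.
have /negP := negbT (before_find 0%N lt_s); rewrite nth_iota // add0n; case.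
by apply/path_of_lengthP; exists p'.
Qed.

Hypothesis connG : connected_graph G.

(** Connectivity makes the search succeed: a duplicate-free path visits at most [N] vertices, so its
    length is among those tried. *)
Lemma dist_walk i j :
  exists p, [/\ path adj i p, last i p = j & size p = dist i j].
Proof.
have /connectP[p0 hp0 hl] := connG i j.
have hh : has (fun k => path_of_length G k i j) (iota 0 N).
  move: hl; have [p hp hu _] := shortenP hp0 => hl.
  apply/hasP; exists (size p); last by apply/path_of_lengthP; exists p.
  rewrite mem_iota /= add0n; have /card_uniqP /= <- := hu.
  by rewrite -[leqRHS]card_ord max_card.
have := nth_find 0%N hh.
rewrite nth_iota; last by move: hh; rewrite has_find size_iota.
by rewrite add0n => /path_of_lengthP[p [? ? _ ?]]; exists p.
Qed.

Lemma distxx i : dist i i = 0%N.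
Proof. by apply/eqP; rewrite -leqn0; apply: (@dist_le_walk i [::]). Qed.

Lemma dist_eq0 i j : (dist i j == 0%N) = (i == j).
Proof.
apply/eqP/eqP => [d0|->]; last exact: distxx.
by have [[|x p] []] := dist_walk i j; rewrite d0.
Qed.

Lemma dist_sym i j : dist i j = dist j i.
Proof.
suff le x y : (dist x y <= dist y x)%N by apply/eqP; rewrite eqn_leq !le.
have [p [hp <- <-]] := dist_walk y x.
have := @dist_le_walk (last y p) (rev (belast y p)).
rewrite rev_path size_rev size_belast (eq_path (e' := adj)); last first.
  by move=> ? ?; rewrite adj_sym.
have -> : last (last y p) (rev (belast y p)) = y.
  by case: (p) => //= z q; rewrite rev_cons last_rcons.
exact.
Qed.

Lemma dist_adj i l j : adj i l -> (dist i j <= (dist l j).+1)%N.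
Proof.
have [p [hp <- <-]] := dist_walk l j => il.
by apply: (@dist_le_walk i (l :: p)); rewrite /= il.
Qed.

Lemma dist_succ i j r : dist i j = r.+1 -> exists2 l, adj i l & dist l j = r.
Proof.
move=> dr; have [[|l p] [/= hp hl]] := dist_walk i j; rewrite dr // => -[szp].
case/andP: hp => il hp; exists l => //; apply/eqP.
by rewrite eqn_leq -{1}hl -{1}szp dist_le_walk //= -ltnS -dr dist_adj.
Qed.

Lemma dist_le_diameter i j : (dist i j <= diameter G)%N.
Proof.
apply: leq_trans (leq_bigmax (F := fun i => \max_(j < N) dist i j) i).
exact: leq_bigmax.
Qed.

(** Start from a pair at distance [diameter G] and move the first endpoint along a shortest path;
    each step lowers the distance by one. The induction is on the number of steps,
    [diameter G - r]. *)
Lemma dist_eq_ex r : (0 < N)%N -> (r <= diameter G)%N ->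
  exists i j, dist i j = r.
Proof.
move=> N0 /subKn <-; elim: (diameter G - r)%N => [|k [i [j hij]]].
  have cN : (0 < #|'I_N|)%N by rewrite card_ord.
  have [i Ei] := bigop.eq_bigmax (fun i : 'I_N => \max_(j < N) dist i j) cN.
  have [j Ej] := bigop.eq_bigmax (fun j : 'I_N => dist i j) cN.
  by exists i, j; rewrite subn0 /diameter Ei Ej.
rewrite subnS; case E: (_ - k)%N hij => [|m] hij; first by exists i, j.
by have [l _ hl] := dist_succ hij; exists l, j.
Qed.

End Distance.

(** * Splitting real polynomials through their complex roots *)

Section Splitting.
Variable R : rcfType.

Lemma size_quadratic (a b : R) :
  size (('X - a%:P) ^+ 2 + (b ^+ 2)%:P) = 3%N.
Proof. by rewrite size_addl size_exp_XsubC // size_polyC; case: eqP. Qed.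

(** The remainder is [c + d X] with real [c] and [d], and it vanishes at [a + ib]. The imaginary
    part [d b = 0] gives [d = 0], and then the real part gives [c = 0]. *)
Lemma dvdp_quadratic_of_complex_root (p : {poly R}) (a b : R) :
  b != 0 -> root (map_poly (real_complex R) p) (a +i* b)%C ->
  (('X - a%:P) ^+ 2 + (b ^+ 2)%:P) %| p.
Proof.
move=> b0; set g := _ + _ => /rootP.
have sg : size g = 3%N by exact: size_quadratic.
have rg : (map_poly (real_complex R) g).[(a +i* b)%C] = 0.
  rewrite /g !rmorphD /= rmorphXn rmorphB /= map_polyX !map_polyC /=.
  rewrite !hornerE /=; apply/eqP; rewrite eq_complex /=; simpc.
  by rewrite -expr2 addNr !eqxx.
rewrite [p in map_poly _ p](divp_eq p g) rmorphD rmorphM hornerD hornerM.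
rewrite rg mulr0 add0r.
have g0 : g != 0 by rewrite -size_poly_eq0 sg.
have := ltn_modp p g; rewrite g0 sg => sr.
have Er : p %% g = ((p %% g)`_0)%:P + (p %% g)`_1 *: 'X.
  apply/polyP=> -[|[|k]]; rewrite coefD coefC coefZ coefX /= ?mulr0 ?addr0 //.
    by rewrite mulr1 add0r.
  by rewrite nth_default ?addr0 // -ltnS (leq_trans sr).
rewrite {1}Er rmorphD /= map_polyC map_polyZ map_polyX /= !hornerE /=.
set c := _`_0; set d := _`_1.
move/eqP; rewrite eq_complex /=; simpc => /andP[/eqP h1 /eqP h2].
have d0 : d = 0 by move/eqP: h2; rewrite mulf_eq0 (negPf b0) orbF => /eqP.
move: h1; rewrite d0 mul0r addr0 => c0; apply/modp_eq0P.
by rewrite Er -/c -/d c0 d0 scale0r addr0 polyC0.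
Qed.

(** A nonconstant [p] has a complex root, which is real since otherwise its quadratic would divide
    [p]. Its linear factor is split off, and the quotient inherits the hypothesis. *)
Lemma poly_split_real (p : {poly R}) : p != 0 ->
  (forall a b, b != 0 -> ~~ ((('X - a%:P) ^+ 2 + (b ^+ 2)%:P) %| p)) ->
  exists2 s : seq R, size p = (size s).+1 &
    p = lead_coef p *: \prod_(x <- s) ('X - x%:P).
Proof.
have [n] := ubnP (size p); elim: n p => // n IHn p le_n p0 hp.
have [le1|sp] := leqP (size p) 1.
  have sz1 : size p = 1%N by apply/eqP; rewrite eqn_leq le1 size_poly_gt0.
  exists [::]; rewrite ?sz1 // big_nil lead_coefE sz1 -mul_polyC mulr1.
  exact: size1_polyC.
have : size (map_poly (real_complex R) p) != 1%N.
  by rewrite size_map_poly neq_ltn sp orbT.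
case/closed_rootP => -[a b] rab.
have b0 : b = 0.
  apply/eqP/negPn/negP => b0; case/negP: (hp a b b0).
  exact: dvdp_quadratic_of_complex_root.
have /factor_theorem[q Eq] : root p a.
  by rewrite -(fmorph_root (real_complex R)); rewrite b0 in rab.
have q0 : q != 0 by apply: contra_neq p0 => q0; rewrite Eq q0 mul0r.
have szp : size p = (size q).+1.
  by rewrite Eq size_Mmonic ?monicXsubC // size_XsubC addn2.
have [| //| |s ss Es] := IHn q; first by rewrite -ltnS -szp.
  by move=> c d d0; apply: contra (hp c d d0) => h; rewrite Eq dvdp_mulr.
exists (a :: s); first by rewrite szp ss.
rewrite big_cons {1}Eq {1}Es -scalerAl Eq.
by rewrite lead_coef_Mmonic ?monicXsubC // mulrC.
Qed.

End Splitting.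

(** * Positivity of the trace form *)

Section SymmetricMatrix.
Variables (R : realFieldType) (n : nat).
Local Notation M := 'M[R]_n.+1.

Lemma mxtrace_tr_mul_ge0 (X : M) : 0 <= \tr (X^T *m X).
Proof.
apply: sumr_ge0 => i _; rewrite mxE; apply: sumr_ge0 => j _.
by rewrite mxE -expr2 sqr_ge0.
Qed.

(** The trace is the sum of the squares of all entries of [X]. *)
Lemma mxtrace_tr_mul_eq0 (X : M) : \tr (X^T *m X) = 0 -> X = 0.
Proof.
have pos i j : 0 <= X^T i j * X j i by rewrite mxE -expr2 sqr_ge0.
rewrite /mxtrace => /psumr_eq0P h; apply/matrixP => j i; rewrite mxE.
have /h/(_ i isT) : forall i, true -> 0 <= (X^T *m X) i i.
  by move=> k _; rewrite mxE sumr_ge0.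
rewrite mxE => /psumr_eq0P/(_ j isT)/eqP; rewrite mxE mulf_eq0 orbb => E.
by apply/eqP/E => k _; exact: pos.
Qed.

Lemma sym_quadratic_eq0 (A H : M) (a b : R) : A^T = A -> b != 0 ->
  horner_mx A (('X - a%:P) ^+ 2 + (b ^+ 2)%:P) *m H = 0 -> H = 0.
Proof.
move=> symA b0; rewrite rmorphD rmorphXn rmorphB /= horner_mx_X !horner_mx_C.
set B := A - a%:M => h.
have symB : B^T = B by rewrite linearB /= symA tr_scalar_mx.
have : \tr ((B *m H)^T *m (B *m H)) + b ^+ 2 * \tr (H^T *m H) = 0.
  rewrite -mxtraceZ -mxtraceD trmx_mul symB -mulmxA (mulmxA B) scalemxAr -mulmxDr.
  by rewrite -mul_scalar_mx -mulmxDl -[B *m B]/(B ^+ 2) h mulmx0 mxtrace0.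
move/eqP; rewrite paddr_eq0 ?mxtrace_tr_mul_ge0 //; last first.
  by apply: mulr_ge0; rewrite ?sqr_ge0 ?mxtrace_tr_mul_ge0.
case/andP=> _; rewrite mulf_eq0 expf_eq0 /= (negPf b0) => /eqP.
exact: mxtrace_tr_mul_eq0.
Qed.

End SymmetricMatrix.

(** * Polynomials in the adjacency matrix *)

Section AdjacencyAlgebra.
Variables (R : rcfType) (n : nat) (G : simple_graph n.+1).
Hypothesis connG : connected_graph G.
Local Notation adj := (adj G).
Local Notation dist := (dist G).
Local Notation D := (diameter G).

Definition adjmx : 'M[R]_n.+1 := \matrix_(i, j) (adj i j)%:R.

(** The strict inequality makes [ballmx 0] zero and [ballmx 1] the identity, so that the index
    bounds the size of the representing polynomial. *)
Definition ballmx (t : nat) : 'M[R]_n.+1 := \matrix_(i, j) (dist i j < t)%N%:R.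

Lemma adjmx_ballmx t i j :
  (adjmx *m ballmx t) i j = #|[set l | adj i l & (dist l j < t)%N]|%:R.
Proof.
rewrite mxE -sum1_card natr_sum [RHS]big_mkcond; apply: eq_bigr => l _ /=.
by rewrite !mxE inE; case: (adj i l); case: (_ < t)%N; rewrite ?mul1r ?mul0r.
Qed.

Lemma adjmx_exp_gt_dist m i j : (m < dist i j)%N -> (adjmx ^+ m) i j = 0.
Proof.
elim: m i => [|m IHm] i lt_m.
  by rewrite expr0 mxE; case: eqP lt_m => // ->; rewrite distxx.
rewrite exprS mxE big1 // => l _; rewrite mxE.
case il: (adj i l); last by rewrite mul0r.
by rewrite IHm ?mulr0 // -ltnS (leq_trans lt_m) // dist_adj.
Qed.

Lemma adjmx_exp_ge0 m i j : 0 <= (adjmx ^+ m) i j.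
Proof.
elim: m i => [|m IHm] i; first by rewrite expr0 mxE ler0n.
by rewrite exprS mxE sumr_ge0 // => l _; rewrite mulr_ge0 // mxE ler0n.
Qed.

(** A neighbour of [i] one step closer to [j] contributes a positive term, and no term is negative,
    so nothing cancels. *)
Lemma adjmx_exp_dist m i j : dist i j = m -> 0 < (adjmx ^+ m) i j.
Proof.
elim: m i => [|m IHm] i dm.
  by rewrite expr0 mxE -(dist_eq0 connG) dm ltr01.
have [l il lm] := dist_succ connG dm.
rewrite exprS mxE (bigD1 l) //= ltr_wpDr //.
  by rewrite sumr_ge0 // => k _; rewrite mulr_ge0 ?adjmx_exp_ge0 // mxE ler0n.
by rewrite mxE il mul1r IHm.
Qed.

Lemma horner_adjmx_neq0 (f : {poly R}) :
  f != 0 -> (size f <= D.+1)%N -> horner_mx adjmx f != 0.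
Proof.
move=> f0; case sz: (size f) => [|m] lem; first by rewrite -size_poly_eq0 sz in f0.
have [i [j dm]] := dist_eq_ex connG (ltn0Sn n) lem.
apply/eqP => /matrixP/(_ i j); rewrite -[f in LHS]coefK poly_def sz linear_sum summxE /=.
rewrite big_ord_recr /= big1 ?add0r => [|k _].
  rewrite linearZ /= rmorphXn /= horner_mx_X !mxE => /eqP.
  rewrite mulf_eq0 (gt_eqF (adjmx_exp_dist dm)) orbF.
  by move: f0; rewrite -lead_coef_eq0 lead_coefE sz => /negPf ->.
rewrite linearZ /= rmorphXn /= horner_mx_X mxE.
by rewrite adjmx_exp_gt_dist ?mulr0 // dm.
Qed.

Lemma adjmx_annihilator_split (p : {poly R}) (k : R) : p != 0 ->
  (size p <= D.+1)%N -> horner_mx adjmx (p * ('X - k%:P)) = 0 ->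
  exists2 s : seq R, size s = D & p = lead_coef p *: \prod_(x <- s) ('X - x%:P).
Proof.
move=> p0 szp pk.
have k0 : 'X - k%:P != 0 by rewrite polyXsubC_eq0.
have szp' : size p = D.+1.
  (* If [size p <= D], then [p * ('X - k%:P)] would be a nonzero annihilator of size at most
     [D.+1]. *)
  apply/eqP; rewrite eqn_leq szp ltnNge; apply/negP => szD.
  have := @horner_adjmx_neq0 (p * ('X - k%:P)).
  rewrite pk eqxx mulf_neq0 // size_Mmonic ?monicXsubC // size_XsubC addn2.
  by move=> /(_ isT szD).
have [//|a b b0|s ss Es] := @poly_split_real R p.
  apply/negP => /dvdpP[q Eq]; set g := _ + _ in Eq.
  have q0 : q != 0 by apply: contra_neq p0 => q0; rewrite Eq q0 mul0r.
  have sg : size g = 3%N by exact: size_quadratic.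
  have g0 : g != 0 by rewrite -size_poly_eq0 sg.
  have := @horner_adjmx_neq0 (q * ('X - k%:P)).
  rewrite mulf_neq0 // size_Mmonic ?monicXsubC // size_XsubC addn2 /=.
  have := size_mul q0 g0; rewrite -Eq szp' sg addn3 /= => -[->].
  move=> /(_ isT (leqnSn _))/eqP; apply.
  apply: (@sym_quadratic_eq0 R n adjmx _ a b) => //.
    by apply/matrixP => i j; rewrite !mxE adj_sym.
  by rewrite -/g -[_ *m _]/(_ * _) -rmorphM mulrA [g * q]mulrC -Eq.
by exists s => //; move: szp'; rewrite ss => -[].
Qed.

(** * Intersection numbers and ball matrices *)

Variables (k : nat) (b c : nat -> nat).
Hypothesis degG : forall i, #|[set l | adj i l]| = k.
Hypothesis bc : forall (r : nat) (i j : 'I_n.+1), dist i j = r ->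
  ((1 <= r <= D)%N -> c r = #|[set k in sphere G r.-1 j | adj i k]|) /\
  ((r < D)%N -> b r = #|[set k in sphere G r.+1 j | adj i k]|).

(** The left entry counts the neighbours of [i] within distance [t] of [j]. These are all [k] of
    them if [dist i j < t], all but [b t] at distance [t], [c t.+1] at distance [t.+1], and none
    beyond. *)
Lemma adjmx_ballmx_rec t : (t < D)%N ->
  adjmx *m ballmx t.+1 = k%:R *: ballmx t
    + (k%:R - (b t)%:R) *: (ballmx t.+1 - ballmx t)
    + (c t.+1)%:R *: (ballmx t.+2 - ballmx t.+1).
Proof.
move=> tD; apply/matrixP => i j; rewrite adjmx_ballmx !mxE.
have [lt_t|gt_t|eq_t] := ltngtP (dist i j) t.
- rewrite !ltnS (ltnW lt_t) (leq_trans (ltnW lt_t) (leqnSn t)) !subrr !mulr0 !addr0 mulr1.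
  congr _%:R; rewrite -(degG i); apply: eq_card => l; rewrite !inE.
  case il: (adj i l) => //=; rewrite ltnS (leq_trans _ lt_t) // dist_adj //.
  by rewrite adj_sym.
- rewrite !ltnS [(dist i j <= t)%N]leqNgt gt_t subrr !mulr0 !add0r subr0.
  have [le1|gt1] := leqP (dist i j) t.+1.
    have eq1 : dist i j = t.+1 by apply/eqP; rewrite eqn_leq le1.
    have [/(_ tD) -> _] := bc eq1; rewrite mulr1; congr _%:R.
    apply: eq_card => l; rewrite !inE andbC [dist j l]dist_sym //.
    case il: (adj i l); rewrite ?andbF ?andbT // eqn_leq ltnS.
    by rewrite andb_idr // => _; rewrite -ltnS -eq1 dist_adj.
  rewrite mulr0 [X in X%:R](_ : _ = 0%N) //; apply/eqP; rewrite cards_eq0.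
  apply/eqP/setP => l; rewrite !inE; case il: (adj i l) => //=.
  apply/negbTE; rewrite -leqNgt -ltnS (leq_trans gt1) // dist_adj //.
- rewrite eq_t ltnSn ltnS leqnSn subrr !mulr0 subr0 mulr1 addr0 add0r.
  have [_ /(_ tD) ->] := bc eq_t; rewrite -(degG i).
  (* Neighbours outside the ball are at distance exactly [t.+1], hence counted by [b t]. *)
  rewrite -(cardsID [set l | (dist l j < t.+1)%N] [set l | adj i l]) natrD.
  apply/esym/eqP; rewrite subr_eq; apply/eqP; congr (_%:R + _%:R); apply: eq_card => l.
    by rewrite !inE.
  rewrite !inE [dist j l]dist_sym //; case il: (adj i l); rewrite ?andbF ?andbT //.
  by rewrite -leqNgt eqn_leq -{2}eq_t dist_adj // adj_sym.
Qed.

(** The first step of a shortest path between vertices at distance [t.+1] is counted by [c t.+1].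
    This lets the recurrence be solved for [ballmx t.+2]. *)
Lemma intersection_neq0 t : (t < D)%N -> (c t.+1)%:R != 0 :> R.
Proof.
move=> tD; have [i [j dm]] := dist_eq_ex connG (ltn0Sn n) tD.
have [/(_ tD) -> _] := bc dm; have [l il dl] := dist_succ connG dm.
rewrite pnatr_eq0 cards_eq0; apply/set0Pn; exists l.
by rewrite !inE il dist_sym // dl eqxx.
Qed.

Lemma ballmx_poly t : (t <= D.+1)%N ->
  exists2 p : {poly R}, (size p <= t)%N & horner_mx adjmx p = ballmx t.
Proof.
elim/ltn_ind: t => -[|[|t]] IH le_t.
- exists 0; first by rewrite size_poly0.
  by rewrite rmorph0; apply/matrixP => i j; rewrite !mxE.
- exists 1; first by rewrite size_poly1.
  by rewrite rmorph1; apply/matrixP => i j; rewrite !mxE ltnS leqn0 dist_eq0.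
have [p sp Ep] := IH t (ltnW (ltnSn _)) (ltnW (ltnW le_t)).
have [q sq Eq] := IH t.+1 (ltnSn _) (ltnW le_t).
pose u : R := (k%:R - (b t)%:R).
(* The recurrence solved for [ballmx t.+2], with [p] and [q] standing for [ballmx t] and
   [ballmx t.+1]; the factor ['X] raises the size by one. *)
exists ((c t.+1)%:R^-1 *: ('X * q - k%:R *: p - u *: (q - p)) + q).
  have sp2 := leq_trans sp (leqW (leqnSn t)).
  have sq2 := leq_trans sq (leqnSn t.+1).
  rewrite (leq_trans (size_polyD _ _)) // geq_max sq2 andbT.
  rewrite (leq_trans (size_scale_leq _ _)) // (leq_trans (size_polyD _ _)) //.
  rewrite geq_max size_polyN (leq_trans (size_scale_leq _ _)) ?andbT; last first.
    by rewrite (leq_trans (size_polyD _ _)) // geq_max size_polyN sq2.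
  rewrite (leq_trans (size_polyD _ _)) // geq_max size_polyN.
  rewrite (leq_trans (size_scale_leq _ _)) ?andbT //.
  by rewrite (leq_trans (size_polyMleq _ _)) // size_polyX /= ltnS.
rewrite rmorphD /= linearZ /= !rmorphB /= rmorphM /= !linearZ /= !rmorphB /=.
rewrite horner_mx_X Ep Eq.
rewrite -[_ * _]/(_ *m _) adjmx_ballmx_rec //.
rewrite -/u !scalerN -[X in _ *: X]addrA -opprD [X in _ *: X]addrC addKr.
by rewrite scalerA mulVf ?intersection_neq0 // scale1r subrK.
Qed.

End AdjacencyAlgebra.

Theorem proposition7 (R : realType) (N : nat) (G : simple_graph N)
    (hG : distance_regular G) :
  exists M : 'I_(diameter G) -> 'M[R]_N,
    (forall k, complies G (M k)) /\
    exists2 a : R, a != 0 &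
      \prod_(k < diameter G) M k = a *: (ones R N *m (ones R N)^T).
Proof.
case: N G hG => [|n] G [connG [b [c bc]]].
  exists (fun _ => 0); split=> [k|]; first by case.
  by exists 1; rewrite ?oner_eq0 //; apply/matrixP; case.
(* For positive diameter the valency is [b 0]. At diameter 0 the value [b 0] is unconstrained, but
   there is a single vertex, whose degree serves. *)
have [k degG] : exists k, forall i, #|[set l | adj G i l]| = k.
  have [D0|Dpos] := posnP (diameter G).
    exists #|[set l | adj G ord0 l]| => i; have -> // : i = ord0.
    by apply/eqP; rewrite -(dist_eq0 connG) -leqn0 -D0 dist_le_diameter.
  exists (b 0%N) => i; have [_ /(_ Dpos) ->] := bc 0%N i i (distxx G i).
  apply: eq_card => l; rewrite !inE andbC; case il: (adj G i l) => //=.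
  apply/esym/eqP/anti_leq; rewrite lt0n dist_eq0 //.
  rewrite -[in X in (_ <= X)%N](distxx G l) dist_adj //=.
  by apply: contraL il => /eqP ->; rewrite adj_irr.
set D := diameter G in bc *; set A := adjmx R G.
have [p szp Ep] := ballmx_poly R connG degG bc (leqnn D.+1).
have EJ : ballmx R G D.+1 = const_mx 1.
  by apply/matrixP => i j; rewrite !mxE ltnS dist_le_diameter.
rewrite EJ in Ep.
have p0 : p != 0.
  apply/eqP => p0; move: Ep; rewrite p0 rmorph0 => /matrixP/(_ ord0 ord0)/eqP.
  by rewrite !mxE eq_sym oner_eq0.
have [|s ss Es] := adjmx_annihilator_split connG (k := k%:R) p0 szp.
  (* Since [p(A)] is the all-ones matrix, the claim is that every row of [A] sums to [k]. *)
  rewrite mulrC rmorphM rmorphB /= horner_mx_X horner_mx_C Ep -/A mulrBl.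
  rewrite -EJ -[A * _]/(A *m _) -[_%:M * _]/(_%:M *m _) mul_scalar_mx.
  apply/matrixP => i j; rewrite mxE adjmx_ballmx !mxE ltnS dist_le_diameter // mulr1.
  apply/eqP; rewrite subr_eq0; apply/eqP; congr _%:R; rewrite -(degG i).
  by apply: eq_card => l; rewrite !inE ltnS dist_le_diameter andbT.
(* Shifting [A] by a scalar matrix changes only the diagonal, which [complies] leaves free. *)
exists (fun i : 'I_D => A - (s`_i)%:M); split=> [i x y xy nxy|].
  by rewrite !mxE (negPf xy) (negPf nxy) subr0.
exists (lead_coef p)^-1; first by rewrite invr_eq0 lead_coef_eq0.
rewrite (_ : _ *m _ = const_mx 1); last first.
  by apply/matrixP => i j; rewrite !mxE big_ord1 !mxE mulr1.
rewrite -Ep [p in horner_mx _ p]Es linearZ /= scalerA mulVf ?lead_coef_eq0 // scale1r.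
rewrite (big_nth 0) big_mkord ss rmorph_prod; apply: eq_bigr => i _.
by rewrite rmorphB /= horner_mx_X horner_mx_C.
Qed.
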